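(* Let $q,b$ be complex numbers with $|q|<1$ and $b\neq -q^{-N}$ for any positive integer $N$. Then for all positive integers $m$ and $n$, $$\sum_{0\leq a_1\leq a_2\leq \dots \leq a_n}^{''}\frac{q^{m(a_1+a_2+\dots +a_n)}}{\prod_{j=0}^{n-1}\prod_{k=0}^{m}\left(1+bq^{jm+k+a_{j+1}}\right)}=\frac{1}{(q^m;q^m)_n\,(-bq;q)_{mn}},$$ where the sum is over all $n$-tuples $(a_1,\dots,a_n)$ of integers satisfying $0\leq a_1\leq a_2\leq\dots\leq a_n$, and the notation $\sum^{''}$ means that, for each $i$ with $1\le i\le n-1$ and $a_{i+1}=a_i$, the factor $1+bq^{im+a_i}$ (which arises in the double product both from $(j,k)=(i-1,m)$ and from $(j,k)=(i,0)$) is included just once in the denominator product, and in addition, if $a_1=0$, then the factor $1+b=1+bq^{0+0}$ (arising from $(j,k)=(0,0)$) does not appear in the denominator product.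
   Context: Notation: $(x;q)_0=1$ and $(x;q)_n=\prod_{j=0}^{n-1}(1-xq^{j})$ for $n\ge 1$; thus $(q^m;q^m)_n=\prod_{j=1}^{n}(1-q^{mj})$ and $(-bq;q)_{mn}=\prod_{j=1}^{mn}(1+bq^{j})$. The condition $b\ne -q^{-N}$ means $1+bq^N\neq 0$. The omitted factors are deleted from the denominator product before the quotient is formed (so $b=-1$ is allowed). *)

(* Defs.v *)
From HB Require Import structures.
From mathcomp Require Import all_boot all_order all_algebra finmap.
From mathcomp Require Import boolp classical_sets reals topology normedtype.
From mathcomp.analysis.showcase Require Import summability.
From mathcomp Require Import complex.

Set Implicit Arguments.
Unset Strict Implicit.
Unset Printing Implicit Defensive.

Import Order.TTheory GRing.Theory Num.Theory.
Import numFieldNormedType.Exports.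

Local Open Scope ring_scope.

Definition qpoch (K : pzRingType) (x q : K) (n : nat) : K :=
  \prod_(j < n) (1 - x * q ^+ j).

Definition ndtuple (n : nat) := {a : n.-tuple nat | sorted leq a}.

(* With a = (a_1, ..., a_n) stored from position 0, [tnth a j] is a_(j+1).
   The factor (j, k) is deleted when k = 0 and either j = 0 and a_1 = 0, or
   j > 0 and a_(j+1) = a_j; in the latter case its copy (j - 1, m) stays. *)
Definition omitted (n : nat) (a : n.-tuple nat) (j : 'I_n) (k : nat) : bool :=
  (k == 0)%N &&
  (if (j : nat) is i.+1 then tnth a j == nth 0%N a i else tnth a j == 0%N).

Definition denominator (K : pzRingType) (q b : K) (m n : nat)
    (a : n.-tuple nat) : K :=
  \prod_(j < n) \prod_(k < m.+1 | ~~ omitted a j k)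
    (1 + b * q ^+ (j * m + k + tnth a j)).

Definition summand (K : fieldType) (q b : K) (m n : nat)
    (a : n.-tuple nat) : K :=
  q ^+ (m * \sum_(j < n) tnth a j) / denominator q b m a.

(* The family x is unconditionally summable with sum s: the finite partial
   sums converge to s along the finite subsets of I ordered by inclusion.
   The topology on K is that of the norm; K^o only makes it inferable. *)
Definition has_sum (K : numFieldType) (I : choiceType) (x : I -> K) (s : K) :
    Prop :=
  (partial_sum x @ totally --> (s : K^o))%classic.

(* Main.v *)
(* Summing over a_n first, then a_(n-1), and so on, each of the n sums telescopes:
   with M = r m and A the value of the previous index, the terms with a > A are
     q^(M a) / prod_(a <= i <= a + M) (1 + b q^i) = g a - g (a + 1)
   for g a = q^(M a) / ((1 - q^M) prod_(a <= i < a + M) (1 + b q^i)), and adding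
   the exceptional term a = A gives
     q^(M A) / ((1 - q^M) prod_(A < i <= A + M) (1 + b q^i)),
   which is again of the shape needed for the next sum. Truncating all indices at
   N costs O(|q|^N). Convergence along arbitrary finite sets follows because the
   summand is O(|q|^(a_1 + ... + a_n)): with y = (1 + |q|) / 2 one has
   |q| <= y^2 by AM-GM, so outside the box [0, N]^n this is at most
   y^N y^(a_1 + ... + a_n). *)
Require Import Defs.
From mathcomp Require Import all_boot all_order all_algebra finmap.
From mathcomp Require Import boolp classical_sets reals topology normedtype.
From mathcomp Require Import sequences complex ring zify.
From mathcomp.analysis.showcase Require Import summability.

Set Implicit Arguments.
Unset Strict Implicit.
Unset Printing Implicit Defensive.

Import Order.TTheory GRing.Theory Num.Theory.
Import numFieldNormedType.Exports.

Local Open Scope ring_scope.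

(** * Truncation of the index set to boxes *)

Fixpoint monoseqs (n A N : nat) : seq (seq nat) :=
  if n is n'.+1 then
    [seq a :: s | a <- index_iota A N.+1, s <- monoseqs n' a N]
  else [:: [::]].

Lemma mem_monoseqs n A N s :
  (s \in monoseqs n A N) =
  [&& size s == n, path leq A s & all (fun a => a <= N)%N s].
Proof.
elim: n A s => [|n IHn] A s /=; first by rewrite inE; case: s.
apply/idP/idP.
  case/allpairsPdep=> a [t [+ + ->]] /=.
  rewrite mem_index_iota IHn ltnS => /andP[-> ->] /and3P[/eqP-> -> ->].
  by rewrite eqxx.
case: s => [|a s] //= /and3P[ss /andP[Aa p] /andP[aN h]].
apply/allpairsPdep; exists a, s; split=> //.
  by rewrite mem_index_iota Aa ltnS.
by rewrite IHn p h -eqSS ss.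
Qed.

Lemma monoseqs_uniq n A N : uniq (monoseqs n A N).
Proof.
elim: n A => [|n IHn] A //=.
apply: allpairs_uniq_dep => //; first exact: iota_uniq.
by move=> [a s] [a' s'] _ _ /= [-> ->].
Qed.

Lemma big_monoseqsS (V : nmodType) n A N (F : seq nat -> V) :
  \sum_(s <- monoseqs n.+1 A N) F s =
  \sum_(A <= a < N.+1) \sum_(s <- monoseqs n a N) F (a :: s).
Proof. by rewrite /= big_allpairs_dep. Qed.

(** The increasing tuples bounded by [N] form the threshold finite set of the filter. Finite subsets
    become duplicate-free lists of plain sequences, which removes the subtypes from all later
    estimates. *)
Lemma has_sum_monoseqs (K : numFieldType) n (W : seq nat -> K) (v : K) :
  (forall e : K, 0 < e -> exists N, forall L : seq (seq nat), uniq L ->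
     {subset monoseqs n 0 N <= L} ->
     (forall s, s \in L -> size s = n /\ path leq 0 s) ->
     `|v - \sum_(s <- L) W s| < e) ->
  has_sum (fun a : ndtuple n => W (val (val a))) v.
Proof.
move=> H; apply/(@cvgrPdist_lt K K^o _ _ totally_filter) => e /H[N HN].
pose B : {fset ndtuple n} :=
  seq_fset tt (pmap insub (pmap insub (monoseqs n 0 N))).
exists B => // S /= BS.
rewrite /partial_sum -(big_seq_fsetE _ _ xpredT (fun a => W (val (val a)))) /=.
rewrite -(big_map (fun a : ndtuple n => val (val a)) xpredT W).
apply: HN.
- rewrite map_inj_uniq ?fset_uniq//.
  by apply: (inj_comp val_inj val_inj).
- move=> s sN; move: (sN); rewrite mem_monoseqs => /and3P[ss ps _].
  have st : sorted leq (Tuple ss) by exact: path_sorted ps.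
  apply/mapP; exists (@exist _ (fun a : n.-tuple nat => sorted leq a : Prop) _ st) => //.
  apply: (fsubsetP BS); rewrite seq_fsetE.
  by rewrite !mem_pmap_sub /=.
- move=> s /mapP[a _ ->]; split; first by rewrite size_tuple.
  by rewrite path_min_sorted ?(valP a)//; apply/allP.
Qed.

(** * Closed form of the iterated sums by telescoping *)

Section Closed.
Variables (K : fieldType) (q : K) (m : nat).

Definition qprod (b : K) (u v : nat) : K := \prod_(u <= i < v) (1 + b * q ^+ i).

(* Peeling off a_1 replaces b by b q^m. The argument A is the value preceding s;
   A = 0 encodes the exceptional rule for a_1. *)
Fixpoint term (b : K) (A : nat) (s : seq nat) : K :=
  if s is a :: s' then
    q ^+ (m * a) / qprod b (a + (a == A)) (a + m.+1) * term (b * q ^+ m) a s'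
  else 1.

(** Limit, for [|q| < 1], of the sums of [term b A s] over increasing [s] of length [r] with entries
    from [A] to [N], as [N] grows. *)
Definition closed_form (b : K) (A r : nat) : K :=
  q ^+ (r * m * A) /
  (qpoch (q ^+ m) (q ^+ m) r * qprod b A.+1 (A + r * m).+1).

Lemma qprod_shift b u v : qprod (b * q ^+ m) u v = qprod b (u + m) (v + m).
Proof.
rewrite /qprod big_addn addnK; apply: eq_bigr => i _.
by rewrite exprD; ring.
Qed.

Lemma qprod_recl b u v : (u < v)%N ->
  qprod b u v = (1 + b * q ^+ u) * qprod b u.+1 v.
Proof. by move=> uv; rewrite /qprod big_ltn. Qed.

Lemma qprod_recr b u v : (u <= v)%N ->
  qprod b u v.+1 = qprod b u v * (1 + b * q ^+ v).
Proof. by move=> uv; rewrite /qprod big_nat_recr. Qed.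

Lemma qprod_cat b u v w : (u <= v)%N -> (v <= w)%N ->
  qprod b u w = qprod b u v * qprod b v w.
Proof. by move=> uv vw; rewrite /qprod (big_cat_nat uv vw). Qed.

(** Deleting the factor [k = 0] raises the lower end of the range by one, so the omission rule is a
    boolean read as a number. *)
Lemma qprod_ord b (e : bool) a :
  \prod_(k < m.+1 | ~~ ((k == 0 :> nat)%N && e)) (1 + b * q ^+ (k + a)) =
  qprod b (a + e) (a + m.+1).
Proof.
case: e; last first.
  rewrite addn0 /qprod -{2}[a]add0n big_addn addKn big_mkord.
  by apply: eq_bigl => k; rewrite andbF.
rewrite big_mkcond big_ord_recl /= mul1r addn1 addnS -addSn.
rewrite /qprod -[X in \prod_(X <= _ < _) _]add0n big_addn addKn big_mkord.
by apply: eq_bigr => k _; rewrite /bump /= addnS addSn.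
Qed.

Lemma term_prod b A s :
  term b A s = q ^+ (m * \sum_(j < size s) nth 0%N s j) /
  \prod_(j < size s)
    \prod_(k < m.+1 | ~~ ((k == 0 :> nat)%N && (nth 0%N s j == nth 0%N (A :: s) j)))
      (1 + b * q ^+ (j * m + k + nth 0%N s j)).
Proof.
elim: s b A => [|a s IHs] b A /=.
  by rewrite !big_ord0 muln0 expr0 invr1 mulr1.
rewrite IHs !big_ord_recl /= qprod_ord mulnDr exprD invfM.
rewrite -!mulrA; congr (_ * _); rewrite mulrCA; congr (_ * (_ * _^-1)).
apply: eq_bigr => j _; apply: eq_big => // k _.
by rewrite -mulrA -exprD /bump /= !addnA.
Qed.

Lemma summand_term b n (a : n.-tuple nat) : summand q b m a = term b 0 a.
Proof.
rewrite /summand /denominator term_prod size_tuple.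
congr (_ ^+ (m * _) / _); first by apply: eq_bigr => j _; rewrite (tnth_nth 0%N).
apply: eq_bigr => j _; apply: eq_big => [k|k _]; last by rewrite (tnth_nth 0%N).
by rewrite /omitted (tnth_nth 0%N); case: j => -[|j].
Qed.

(** The factors of the first index end where those of the shifted closed form begin, so they merge
    into one product of the telescoping shape with [M = r.+1 * m]. *)
Lemma closed_form_step b A a r :
  q ^+ (m * a) / qprod b (a + (a == A)) (a + m.+1) *
    closed_form (b * q ^+ m) a r =
  (qpoch (q ^+ m) (q ^+ m) r)^-1 *
  (q ^+ (r.+1 * m * a) /
   qprod b (a + (a == A)) (a + r.+1 * m).+1).
Proof.
rewrite /closed_form qprod_shift (@qprod_cat _ _ (a + m.+1) (a + r.+1 * m).+1); try by lia.
have -> : (a.+1 + m = a + m.+1)%N by lia.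
have -> : ((a + r * m).+1 + m = (a + r.+1 * m).+1)%N by lia.
have -> : (r.+1 * m * a = m * a + r * m * a)%N by lia.
by rewrite exprD !invfM; ring.
Qed.

Lemma qprod_neq0 b u v : (0 < u)%N ->
  (forall i, (0 < i)%N -> 1 + b * q ^+ i != 0) -> qprod b u v != 0.
Proof.
move=> u0 hb; rewrite /qprod prodf_seq_neq0; apply/allP => i.
by rewrite mem_index_iota => /andP[ui _] /=; apply/hb/leq_trans/ui.
Qed.

Lemma telescope b M A N : (A <= N)%N -> 1 - q ^+ M != 0 ->
  (forall i, (0 < i)%N -> 1 + b * q ^+ i != 0) ->
  \sum_(A <= a < N.+1) q ^+ (M * a) / qprod b (a + (a == A)) (a + M).+1 =
  (q ^+ (M * A) / qprod b A.+1 (A + M).+1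
   - q ^+ (M * N.+1) / qprod b N.+1 (N.+1 + M)) / (1 - q ^+ M).
Proof.
move=> + qM hb.
have base a : \sum_(a <= i < a.+1)
    q ^+ (M * i) / qprod b (i + (i == a)) (i + M).+1 =
  (q ^+ (M * a) / qprod b a.+1 (a + M).+1
   - q ^+ (M * a.+1) / qprod b a.+1 (a.+1 + M)) / (1 - q ^+ M).
  rewrite big_nat1 eqxx addn1 addSn mulnS exprD.
  have := @qprod_neq0 b a.+1 (a + M).+1 isT hb.
  by move: (qprod _ _ _) => P P0; field; rewrite P0 qM.
elim: N => [|N IHN]; first by rewrite leqn0 => /eqP->.
rewrite leq_eqVlt => /orP[/eqP->|AN]; first exact: base.
rewrite big_nat_recr /=; last exact: leqW.
rewrite {}IHN // gtn_eqF // addn0 !addSn (mulnS _ N.+1) exprD.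
have P0 := @qprod_neq0 b N.+2 (N + M).+2 isT hb.
have h1 := hb N.+1 isT; have h2 := hb (N + M).+1 isT.
(* The products at [N.+1] are expressed through the one starting at [N.+2], leaving a rational
   identity. *)
have e1 : qprod b N.+1 (N + M).+2 = (1 + b * q ^+ N.+1) * qprod b N.+2 (N + M).+2.
  by apply: qprod_recl; lia.
have e2 : qprod b N.+1 (N + M).+1 =
    (1 + b * q ^+ N.+1) * qprod b N.+2 (N + M).+2 / (1 + b * q ^+ (N + M).+1).
  by rewrite -e1 (@qprod_recr _ _ (N + M).+1) ?mulfK// ltnS leq_addr.
move: P0 h1 h2; rewrite e1 e2.
have -> : q ^+ (N + M).+1 = q ^+ N.+1 * q ^+ M by rewrite -exprD.
move: (qprod _ _ _) (q ^+ N.+1) => P x P0 h1 h2.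
by field; rewrite qM P0 h1 h2 qprod_neq0.
Qed.

(** Induction step in the number of indices; the subtracted term is the upper boundary of the
    telescoping sum, that is, the truncation error. *)
Lemma sum_closed_form b A N r : (A <= N)%N -> 1 - q ^+ (r.+1 * m) != 0 ->
  (forall i, (0 < i)%N -> 1 + b * q ^+ i != 0) ->
  \sum_(A <= a < N.+1) q ^+ (m * a) / qprod b (a + (a == A)) (a + m.+1) *
    closed_form (b * q ^+ m) a r =
  closed_form b A r.+1 -
  q ^+ (r.+1 * m * N.+1) /
    (qpoch (q ^+ m) (q ^+ m) r.+1 * qprod b N.+1 (N.+1 + r.+1 * m)).
Proof.
move=> AN qM hb.
under eq_bigr do rewrite closed_form_step.
rewrite -big_distrr telescope //= /closed_form /qpoch big_ord_recr /=.
rewrite -exprS -exprM (mulnC m) !invfM; ring.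
Qed.

End Closed.

(** * Geometric bounds and truncation error *)

Lemma geometric_sum_le (K : numFieldType) (y : K) A N : 0 <= y < 1 ->
  \sum_(A <= a < N) y ^+ a <= (1 - y)^-1.
Proof.
move=> /andP[y0 y1]; have d0 : 0 < 1 - y by rewrite subr_gt0.
have le0N : \sum_(A <= a < N) y ^+ a <= \sum_(0 <= a < N) y ^+ a.
  case: (leqP A N) => AN; last first.
    by rewrite [leLHS]big_geq ?(ltnW AN)// sumr_ge0// => i _; rewrite exprn_ge0.
  rewrite [leRHS](big_cat_nat (leq0n A) AN) /= lerDr sumr_ge0// => i _.
  exact: exprn_ge0.
apply: le_trans le0N _; rewrite -[leRHS]mul1r ler_pdivlMr// big_mkord mulrC.
by rewrite -opprB mulNr -subrX1 opprB lerBlDr lerDl exprn_ge0.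
Qed.

Lemma sum_monoseqs_le (K : numFieldType) (y : K) r A N : 0 <= y < 1 ->
  \sum_(s <- monoseqs r A N) y ^+ sumn s <= (1 - y)^-1 ^+ r.
Proof.
move=> y01; have /andP[y0 y1] := y01.
have i0 : 0 <= (1 - y)^-1 by rewrite invr_ge0 subr_ge0 ltW.
elim: r A => [|r IHr] A; first by rewrite /= big_seq1 expr0.
rewrite big_monoseqsS exprS.
apply: (@le_trans _ _ (\sum_(A <= a < N.+1) y ^+ a * (1 - y)^-1 ^+ r)).
  apply: ler_sum => a _; under eq_bigr do rewrite /= exprD.
  by rewrite -big_distrr /= ler_wpM2l ?exprn_ge0.
by rewrite -big_distrl /= ler_wpM2r ?exprn_ge0 ?geometric_sum_le.
Qed.

Section Bounds.
Variables (K : numFieldType) (q C : K) (m : nat).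
Hypotheses (q1 : `|q| < 1) (C1 : 1 <= C) (m0 : (0 < m)%N).

Definition factors_bounded (b : K) :=
  forall i, (0 < i)%N -> 1 + b * q ^+ i != 0 /\ `|(1 + b * q ^+ i)^-1| <= C.

(** The factors for [b * q ^+ m] are among those for [b], so one [C] serves at every level of the
    recursion. *)
Lemma factors_bounded_shift b :
  factors_bounded b -> factors_bounded (b * q ^+ m).
Proof.
move=> hb i i0; rewrite -mulrA -exprD; apply: hb.
by rewrite addn_gt0 i0 orbT.
Qed.

Let C0 : 0 <= C. Proof. exact: le_trans ler01 C1. Qed.

Lemma normV_qprod_le b u v : factors_bounded b -> (0 < u <= v)%N ->
  `|(qprod q b u v)^-1| <= C ^+ (v - u).
Proof.
move=> hb /andP[u0 uv]; rewrite /qprod -prodfV normr_prod.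
rewrite -prodr_const_nat [leLHS]big_nat [leRHS]big_nat; apply: ler_prod => i /andP[ui _].
by rewrite normr_ge0 (hb i (leq_trans u0 ui)).2.
Qed.

Lemma norm_weight_le b A a : factors_bounded b -> (A <= a)%N ->
  `|q ^+ (m * a) / qprod q b (a + (a == A)) (a + m.+1)| <= C ^+ m.+1 * `|q| ^+ a.
Proof.
move=> hb Aa; rewrite normrM mulrC; apply: ler_pM => //.
  apply: le_trans (normV_qprod_le hb _) _.
    (* The possibly zero factor [1 + b] never occurs: either [a = A] and the lower end is [a + 1],
       or [a > A >= 0]. *)
    by case: eqP => [|/eqP] ? /=; lia.
  by apply: ler_weXn2l => //; lia.
by rewrite normrX ler_wiXn2l// ?ltW// leq_pmull.
Qed.

Lemma norm_term_le b A s : factors_bounded b -> path leq A s ->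
  `|term q m b A s| <= C ^+ (m.+1 * size s) * `|q| ^+ sumn s.
Proof.
elim: s b A => [|a s IHs] b A hb /=; first by rewrite muln0 !expr0 normr1 mulr1.
move=> /andP[Aa ps]; rewrite normrM mulnS (exprD C) (exprD _ a) mulrACA.
by apply: ler_pM (norm_weight_le hb Aa) (IHs _ _ (factors_bounded_shift hb) ps).
Qed.

(** [E] is chosen before [b], [A] and [N] because the induction applies the bound to [b * q ^+ m]
    and every first entry [a]. *)
Lemma sum_term_approx r : exists2 E, 0 <= E &
  forall b A N, factors_bounded b -> (A <= N)%N ->
  `|\sum_(s <- monoseqs r A N) term q m b A s - closed_form q m b A r|
    <= E * `|q| ^+ N.
Proof.
have qX k : (0 < k)%N -> 1 - q ^+ k != 0.
  move=> k0; rewrite subr_eq0 eq_sym; apply/eqP => qk.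
  have := q1; rewrite -(@ltr_pXn2r _ k)// ?nnegrE// expr1n -normrX qk normr1.
  by rewrite ltxx.
elim: r => [|r [E E0 IHr]].
  exists 0 => // b A N _ _; rewrite /closed_form /qpoch big_ord0 mul0n addn0 /=.
  by rewrite big_seq1 /qprod big_geq// expr0 mulr1 invr1 mulr1 subrr normr0 mul0r.
pose D := `|(qpoch (q ^+ m) (q ^+ m) r.+1)^-1| * C ^+ (r.+1 * m).
(* The first summand collects the inner errors through a geometric sum; [D] bounds the boundary term
   of the telescoping. *)
exists (C ^+ m.+1 * E / (1 - `|q|) + D).
  by rewrite addr_ge0 ?mulr_ge0 ?exprn_ge0 ?invr_ge0 ?subr_ge0 ?(ltW q1).
move=> b A N hb AN.
have hM : (0 < r.+1 * m)%N by rewrite muln_gt0.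
have hb0 i : (0 < i)%N -> 1 + b * q ^+ i != 0 by move=> /hb[].
have /esym/eqP := sum_closed_form AN (qX _ hM) hb0.
rewrite subr_eq => /eqP->.
rewrite big_monoseqsS /= opprD addrA; under eq_bigr do rewrite -big_distrr /=.
rewrite -sumrB mulrDl; apply: le_trans (ler_normB _ _) _; apply: lerD.
  apply: le_trans (ler_norm_sum _ _ _) _.
  apply: (@le_trans _ _ (\sum_(A <= a < N.+1) C ^+ m.+1 * `|q| ^+ a * (E * `|q| ^+ N))).
    apply: ler_sum_nat => a /andP[Aa aN]; rewrite -mulrBr normrM.
    apply: ler_pM => //; first exact: norm_weight_le.
    by apply: IHr; [exact: factors_bounded_shift|rewrite -ltnS].
  rewrite -big_distrl -big_distrr /=.
  rewrite [leRHS](_ : _ = C ^+ m.+1 * (1 - `|q|)^-1 * (E * `|q| ^+ N)); last by ring.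
  rewrite ler_wpM2r ?mulr_ge0 ?exprn_ge0// ler_wpM2l ?exprn_ge0//.
  by rewrite geometric_sum_le// normr_ge0 q1.
rewrite invfM normrM mulrC normrM ler_pM ?mulr_ge0//.
  rewrite ler_wpM2l//; apply: le_trans (normV_qprod_le hb _) _; first by lia.
  by rewrite addKn.
rewrite normrX ler_wiXn2l// ?ltW//; apply: leq_trans (leqnSn N) _.
by rewrite leq_pmull.
Qed.

End Bounds.

(** * Vanishing powers and a uniform bound on inverse factors *)

Definition powers_vanish (K : numFieldType) :=
  forall y : K, 0 <= y < 1 -> forall e, 0 < e -> exists N, y ^+ N < e.

(** Comparison with 0 in the order of [R[i]] forces the imaginary part to vanish, which leaves the
    real geometric limit. *)
Lemma powers_vanish_complex (R : realType) : powers_vanish R[i].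
Proof.
case=> a c /andP[]; rewrite lecE ltcE /= => /andP[/eqP-> a0] /andP[_ a1].
case=> r d; rewrite ltcE /= => /andP[/eqP-> r0].
have an1 : `|a| < 1 by rewrite ger0_norm.
have /cvgrPdist_lt/(_ r r0)[N _ /(_ N (leqnn N))] := cvg_expr an1.
rewrite /= sub0r normrN ger0_norm ?exprn_ge0// => aN.
by exists N; rewrite -[_ ^+ N](rmorphXn (real_complex R)) ltcR.
Qed.


(** Once [b * q ^+ i] has norm at most 1/2 the inverse is at most 2; the finitely many earlier
    inverses are bounded by their sum. *)
Lemma factors_bounded_exists (K : numFieldType) (q b : K) :
  powers_vanish K -> `|q| < 1 ->
  (forall i, (0 < i)%N -> 1 + b * q ^+ i != 0) ->
  exists2 C, 1 <= C & factors_bounded q C b.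
Proof.
move=> pv q1 hb.
have b0 : 0 < 1 + `|b| by rewrite ltr_wpDr.
have [N qN] : exists N, `|q| ^+ N < (2 * (1 + `|b|))^-1.
  by apply: pv; rewrite ?normr_ge0 ?invr_gt0 ?mulr_gt0.
have S0 : 0 <= \sum_(i < N) `|(1 + b * q ^+ i)^-1| by exact: sumr_ge0.
(* The term [i = 0] is harmless: if [1 + b] vanishes, its inverse is 0 by convention. *)
exists (2 + \sum_(i < N) `|(1 + b * q ^+ i)^-1|).
  by rewrite -[leLHS]addr0 lerD// ler1n.
move=> i i0; split; first exact: hb.
case: (ltnP i N) => iN.
  by rewrite (bigD1 (Ordinal iN)) //= addrCA lerDl addr_ge0 ?sumr_ge0.
apply: (@le_trans _ _ 2); last by rewrite lerDl.
rewrite normfV -[leRHS]invrK lef_pV2 ?posrE ?invr_gt0 ?normr_gt0 ?hb//.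
have : `|b * q ^+ i| <= 2^-1.
  rewrite normrM normrX; apply: (@le_trans _ _ ((1 + `|b|) * (2 * (1 + `|b|))^-1)).
    apply: ler_pM; rewrite ?exprn_ge0// ?lerDr//.
    by apply: le_trans (ltW qN); apply: ler_wiXn2l => //; exact: ltW.
  by rewrite invfM mulrCA divff ?mulr1// gt_eqF.
move=> bq; have := lerB_normD 1 (b * q ^+ i); rewrite normr1; apply: le_trans.
rewrite lerBrDr; apply: le_trans (lerD (lexx _) bq) _.
by rewrite [leLHS](_ : _ = 1)//; field.
Qed.

(** * Unconditional summability and the final formula *)

Lemma has_sum_summand (K : numFieldType) (q b : K) (m n : nat) :
  powers_vanish K -> `|q| < 1 ->
  (forall i, (0 < i)%N -> 1 + b * q ^+ i != 0) -> (0 < m)%N ->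
  has_sum (fun a : ndtuple n => summand q b m (val a)) (closed_form q m b 0 n).
Proof.
move=> pv q1 hb m0.
have [C C1 hC] := factors_bounded_exists pv q1 hb.
have C0 : 0 <= C by exact: le_trans ler01 C1.
have [E E0 hE] := sum_term_approx q1 C1 m0 n.
pose y := (1 + `|q|) / 2.
have y01 : 0 <= y < 1.
  by rewrite divr_ge0 ?addr_ge0//= ltr_pdivrMr// mul1r -[2]/(1 + 1) ltrD2l.
have /andP[y0 y1] := y01.
have qy : `|q| <= y ^+ 2.
  rewrite -subr_ge0 [X in 0 <= X](_ : _ = ((1 - `|q|) / 2) ^+ 2); last first.
    by rewrite /y; field.
  by rewrite exprn_ge0// divr_ge0// subr_ge0 ltW.
have qy' : `|q| <= y.
  by apply: le_trans qy _; rewrite -[leRHS]expr1 ler_wiXn2l// ltW.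
pose F := C ^+ (m.+1 * n) * (1 - y)^-1 ^+ n.
have F0 : 0 <= F by rewrite mulr_ge0 ?exprn_ge0// invr_ge0 subr_ge0 ltW.
rewrite (_ : (fun a : ndtuple n => _) =
             fun a : ndtuple n => term q m b 0 (val (val a))); last first.
  by apply: boolp.funext => a; rewrite summand_term.
apply: has_sum_monoseqs => e e0.
(* [E] accounts for the box and [F] for the rest; the 1 makes the divisor of [e] positive. *)
have EF : 0 < 1 + E + F by rewrite ltr_wpDr// ltr_wpDr.
have [N hN] := pv _ y01 _ (divr_gt0 e0 EF).
exists N => L uL NL hL.
move: hN; rewrite ltr_pdivlMr// => /(le_lt_trans _); apply.
have ynn k : 0 <= y ^+ k by exact: exprn_ge0.
have tail : `|\sum_(s <- L | s \notin monoseqs n 0 N) term q m b 0 s| <= y ^+ N * F.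
  (* A box containing all of [L]; the bound on its geometric sum is independent of [M]. *)
  pose M := (\max_(s <- L) \max_(a <- s) a)%N.
  have LM : {subset L <= monoseqs n 0 M}.
    move=> s sL; have [ss ps] := hL s sL.
    rewrite mem_monoseqs ss eqxx ps /=; apply/allP => a as_.
    rewrite /=; apply: (@leq_trans (\max_(a <- s) a)%N).
      exact: (@leq_bigmax_seq _ _ xpredT id).
    exact: (@leq_bigmax_seq _ _ xpredT (fun s => \max_(a <- s) a)%N).
  apply: le_trans (ler_norm_sum _ _ _) _.
  apply: (@le_trans _ _ (\sum_(s <- L) C ^+ (m.+1 * n) * y ^+ N * y ^+ sumn s)).
    rewrite big_seq_cond [leRHS]big_seq [leRHS](bigID (mem (monoseqs n 0 N))) /=.
    rewrite -[leLHS]add0r; apply: lerD.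
      by apply: sumr_ge0 => s _; rewrite !mulr_ge0 ?exprn_ge0.
    apply: ler_sum => s /andP[sL sN]; have [ss ps] := hL s sL.
    apply: le_trans (norm_term_le q1 C1 m0 hC ps) _; rewrite ss -mulrA.
    rewrite ler_wpM2l ?exprn_ge0//.
    (* Outside the box some entry exceeds [N], so one of the two factors [y ^+ sumn s] is at most
       [y ^+ N]; the other is kept for summation. *)
    have Ns : (N <= sumn s)%N.
      move: sN; rewrite mem_monoseqs ss eqxx ps /= => /allPn[a as_].
      rewrite -ltnNge => /ltnW/leq_trans; apply.
      by rewrite sumnE (big_rem a as_) leq_addr.
    apply: (@le_trans _ _ ((y ^+ 2) ^+ sumn s)); first by rewrite lerXn2r ?nnegrE.
    rewrite -exprM mul2n -addnn exprD ler_wpM2r//.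
    by rewrite ler_wiXn2l// ltW.
  rewrite -big_distrr /= mulrAC mulrC ler_wpM2l// ler_wpM2l ?exprn_ge0//.
  apply: le_trans (sum_monoseqs_le n 0 M y01).
  rewrite [leRHS](bigID (mem L)) /= -[leLHS]addr0.
  apply: lerD; last exact: sumr_ge0.
  rewrite -[leRHS]big_filter [leRHS](perm_big L) //=.
  apply: uniq_perm; rewrite ?filter_uniq ?monoseqs_uniq// => s.
  by rewrite mem_filter andb_idr//; exact: LM.
have main : `|\sum_(s <- L | s \in monoseqs n 0 N) term q m b 0 s
              - closed_form q m b 0 n| <= y ^+ N * E.
  (* Since [L] contains the box, its part inside the box is a permutation of the whole box. *)
  rewrite -big_filter (perm_big (monoseqs n 0 N)); last first.
    apply: uniq_perm; rewrite ?filter_uniq ?monoseqs_uniq// => s.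
    by rewrite mem_filter andb_idr//; exact: NL.
  apply: le_trans (hE _ _ _ hC (leq0n N)) _; rewrite mulrC ler_wpM2r//.
  by rewrite lerXn2r ?nnegrE.
rewrite (bigID (mem (monoseqs n 0 N))) /= opprD addrA.
apply: le_trans (ler_normB _ _) _; rewrite mulrDr lerD//.
by rewrite distrC mulrDr mulr1 (le_trans main)// lerDr.
Qed.

Lemma closed_form0 (K : fieldType) (q b : K) m n :
  closed_form q m b 0 n =
  1 / (qpoch (q ^+ m) (q ^+ m) n * qpoch (- (b * q)) q (m * n)).
Proof.
rewrite /closed_form muln0 expr0 add0n /qprod /qpoch big_add1 big_mkord mulnC.
congr (_ / (_ * _)); apply: eq_bigr => i _.
by rewrite exprS mulrA mulNr opprK.
Qed.

Local Open Scope complex_scope.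

Theorem lemma5 (R : realType) (q b : R[i])
    (hq : `|q| < 1)
    (hb : forall N : nat, (0 < N)%N -> 1 + b * q ^+ N != 0)
    (m n : nat) (hm : (0 < m)%N) (hn : (0 < n)%N) :
  has_sum (fun a : ndtuple n => summand q b m (val a))
    (1 / (qpoch (q ^+ m) (q ^+ m) n * qpoch (- (b * q)) q (m * n))).
Proof.
rewrite -closed_form0.
exact: has_sum_summand (@powers_vanish_complex R) hq hb hm.
Qed.
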